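(* If $\mathfrak b=\mathfrak d$, then $\mathfrak e^\sharp=\omega_1$.
   Context: $\omega^\omega$ carries the coordinatewise order $\le$. A poset is a non-empty set with a reflexive transitive relation. For posets $P,Q$ write $P\succcurlyeq Q$ if there is a function $f:P\to Q$ that is monotone ($p\le p'$ implies $f(p)\le f(p')$) and cofinal (for each $q\in Q$ there is $p\in P$ with $q\le f(p)$). Cardinals are posets under their canonical well-order, and for cardinals $\kappa,\lambda$ the power $\kappa^\lambda$ is the set of functions $\lambda\to\kappa$ with the pointwise order. For a cardinal $\kappa$, $\mathfrak e(\kappa)=\min\{\lambda:\omega^\omega\not\succcurlyeq\kappa^\lambda\}$, where $\lambda$ ranges over cardinals; $\mathfrak e^\sharp=\sup\{\kappa^+:\omega\le\mathrm{cf}(\kappa)=\kappa<\mathfrak e(\kappa)\}$, where $\kappa$ ranges over infinite regular cardinals. $\mathfrak d$ is the smallest cardinality of a cofinal subset of $(\omega^\omega,\le)$, and $\mathfrak b$ is the smallest cardinality of an unbounded subset of $(\omega^\omega,\le^* )$, where $f\le^*g$ iff $f(n)\le g(n)$ for all but finitely many $n$. *)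

(* Defs.v *)
From HB Require Import structures.
From mathcomp Require Import all_boot.
From mathcomp Require Import wochoice boolp classical_sets functions cardinality.

Set Implicit Arguments.
Unset Strict Implicit.
Unset Printing Implicit Defensive.

Local Open Scope classical_set_scope.
Local Open Scope card_scope.

(* Antisymmetry is not required: a preorder on a non-empty type. *)
Record poset := Poset {
  poset_sort :> Type;
  poset_le : poset_sort -> poset_sort -> Prop;
  poset_inhabited : inhabited poset_sort;
  poset_refl : forall x, poset_le x x;
  poset_trans : forall x y z, poset_le x y -> poset_le y z -> poset_le x z }.

Definition succeq (P Q : poset) : Prop :=
  exists f : P -> Q,
    (forall p p', poset_le p p' -> poset_le (f p) (f p')) /\
    (forall q, exists p, poset_le q (f p)).

(* The functions from I to P with the pointwise order. *)
Section Power.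
Variables (P : poset) (I : Type).

Let le (f g : I -> P) := forall i, poset_le (f i) (g i).

Lemma power_inhabited : inhabited (I -> P).
Proof. by have [x] := poset_inhabited P; exact: (inhabits (fun=> x)). Qed.

Lemma power_refl f : le f f.
Proof. by move=> i; exact: poset_refl. Qed.

Lemma power_trans f g h : le f g -> le g h -> le f h.
Proof. by move=> fg gh i; exact: poset_trans (fg i) (gh i). Qed.

Definition power : poset := Poset power_inhabited power_refl power_trans.

End Power.

(* A cardinal is an initial well-order: a well-ordered type that does not
   inject into any of its proper initial segments (with choice: a copy of an
   initial ordinal).  Equality of cardinals is equipotence, [ceq] below, which
   for such well-orders is the same as order isomorphism. *)
Record cardinal := Cardinal {
  cardinal_sort :> Type;
  cardinal_le : rel cardinal_sort;
  cardinal_wo : well_order cardinal_le;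
  cardinal_initial : forall x,
    ~ ([set: cardinal_sort] #<= [set y | cardinal_le y x /\ y <> x]) }.

HB.instance Definition _ := gen_eqMixin cardinal.
HB.instance Definition _ := gen_choiceMixin cardinal.

Definition cle (k l : cardinal) : Prop := [set: k] #<= [set: l].
Definition ceq (k l : cardinal) : Prop := [set: k] #= [set: l].
Definition clt (k l : cardinal) : Prop := cle k l /\ ~ cle l k.

Section CardinalPoset.
Variable k : cardinal.

Lemma cardinal_le_pair (x y : k) : exists z, [/\ z = x \/ z = y,
  cardinal_le z x, cardinal_le z y &
  forall w, w = x \/ w = y -> cardinal_le w x -> cardinal_le w y -> z = w].
Proof.
pose A : {pred k} := fun z => `[< z = x \/ z = y >].
have Ain z : z = x \/ z = y -> z \in A by move=> h; apply/asboolP.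
have [|z [[/asboolP Az lz] uz]] := @cardinal_wo k A.
  by exists x; apply: Ain; left.
exists z; split=> //.
- by apply: lz; apply: Ain; left.
- by apply: lz; apply: Ain; right.
- move=> w wxy wx wy; apply: uz; split; first exact: Ain.
  by move=> v /asboolP[->|->].
Qed.

Lemma cardinal_le_refl (x : k) : cardinal_le x x.
Proof. by have [z [[->|->]]] := cardinal_le_pair x x. Qed.

Lemma cardinal_le_anti (x y : k) :
  cardinal_le x y -> cardinal_le y x -> x = y.
Proof.
move=> xy yx; have [z [_ _ _ uz]] := cardinal_le_pair x y.
have <- : z = x by apply: uz => //; [left | exact: cardinal_le_refl].
by apply: uz => //; [right | exact: cardinal_le_refl].
Qed.

Lemma cardinal_le_trans (x y z : k) :
  cardinal_le x y -> cardinal_le y z -> cardinal_le x z.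
Proof.
move=> xy yz; pose A : {pred k} := fun w => `[< [\/ w = x, w = y | w = z] >].
have [|w [[/asboolP Aw lw] _]] := @cardinal_wo k A.
  by exists x; apply/asboolP; constructor 1.
have [wx wy wz] : [/\ cardinal_le w x, cardinal_le w y & cardinal_le w z].
  by split; apply: lw; apply/asboolP;
    [constructor 1 | constructor 2 | constructor 3].
case: Aw => ?; subst w => //.
- by rewrite (cardinal_le_anti xy wx).
- by rewrite -(cardinal_le_anti yz wy).
Qed.

Definition cardinal_poset (k0 : inhabited k) : poset :=
  @Poset k (fun x y => cardinal_le x y) k0 cardinal_le_refl cardinal_le_trans.

End CardinalPoset.

Lemma leq_well_order : well_order leq.
Proof.
apply: antisymmetric_well_order => [x y|A [x Ax]]; first exact: anti_leq.
have exA : exists n, n \in A by exists x.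
exists (ex_minn exA); case: ex_minnP => m Am minm.
by split=> // y Ay; exact: minm.
Qed.

Lemma leq_initial (n : nat) : ~ ([set: nat] #<= [set m | m <= n /\ m <> n]).
Proof.
move=> natn; apply: infinite_nat; apply: (card_le_finite natn).
by apply: (sub_finite_set _ (finite_II n.+1)) => m /= [].
Qed.

Definition omega : cardinal := Cardinal leq_well_order leq_initial.

Definition omega_omega : poset :=
  power (cardinal_poset (inhabits 0 : inhabited omega)) omega.

(* Least element of a class of cardinals; a junk value (omega) only when the
   class has no least element, i.e. is empty. *)
Definition cmin (C : set cardinal) : cardinal :=
  xget omega [set k | C k /\ forall l, C l -> cle k l].

(* Suprema of sets of cardinals taken among ordinals and among cardinals
   agree. *)
Definition csup (C : set cardinal) : cardinal :=
  cmin [set k | forall l, C l -> cle l k].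

Definition csucc (k : cardinal) : cardinal := cmin [set l | clt k l].

Definition omega1 : cardinal := csucc omega.

Definition cofinal (P : poset) (A : set P) : Prop :=
  forall x, exists2 a, A a & poset_le x a.

Definition cofinality (P : poset) : cardinal :=
  cmin [set k | exists2 A : set P, cofinal A & [set: k] #= A].

Definition frak_d : cardinal := cofinality omega_omega.

Definition le_star (f g : nat -> nat) : Prop :=
  finite_set [set n | ~ (f n <= g n)].

Definition frak_b : cardinal :=
  cmin [set k | exists2 A : set (nat -> nat),
    ~ (exists g, forall f, A f -> le_star f g) & [set: k] #= A].

(* The argument [k0] is only there because a poset is non-empty. *)
Definition frak_e (k : cardinal) (k0 : inhabited k) : cardinal :=
  cmin [set l : cardinal |
    ~ succeq omega_omega (power (cardinal_poset k0) l)].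

Definition frak_e_sharp : cardinal :=
  csup [set m | exists (k : cardinal) (k0 : inhabited k),
    [/\ cle omega (cofinality (cardinal_poset k0)),
        ceq (cofinality (cardinal_poset k0)) k,
        clt k (frak_e k0) &
        m = csucc k]].

(* Main.v *)
From mathcomp Require Import all_boot.
From mathcomp Require Import wochoice boolp classical_sets functions cardinality.
Require Import Defs.

Set Implicit Arguments.
Unset Strict Implicit.
Unset Printing Implicit Defensive.

Local Open Scope classical_set_scope.
Local Open Scope card_scope.

(** Why the theorem holds.  The supremum defining [frak_e_sharp] ranges over a
    single cardinal: under [b = d] the only infinite regular [k < e(k)] is
    [omega], so the supremum is that of the set [{omega^+}].

    [omega] qualifies by diagonalization: if [L] is at least as large as some
    cofinal subset of [P], then no monotone map from [P] to [Q^L] is cofinal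
    ([not_succeq_power]).  So [e(omega)] exists; it is uncountable because
    restricting functions along an injection of [l] into [omega] is a monotone
    cofinal map from [omega^omega] to [omega^l] ([succeq_power]).

    Conversely let [k] be infinite and regular with [k < e(k)], so that
    [omega^omega] has a monotone cofinal map to [k^k].  The same diagonal
    argument excludes [d <= k].  Since [b = d], this leaves [k < b], and
    evaluation at one point gives a monotone cofinal map [g] to [k].  Choose
    for each [x] in [k] a function whose image lies above [x]; these are fewer
    than [b] functions, so some [G] dominates all of them modulo finite sets.
    Then the values of [g] at the countably many functions [max(G, m)] are
    cofinal in [k] ([succeq_below_frak_b]), and regularity makes [k]
    countable.

    Minima of classes of cardinals are handled by comparing sizes of arbitrary
    families of types ([card_le_min]), and every type is shown to have a
    cardinal ([exists_cardinal]), so that each invariant is a genuine minimum. *)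

(** * Sizes of types *)

Lemma card_leTTP (T U : Type) :
  [set: T] #<= [set: U] <-> exists f : T -> U, injective f.
Proof.
split=> [/card_leP[f]|[f finj]].
  exists (fun x => val (f (to_setT x))) => x y /val_inj fxy.
  have /(congr1 val) // : to_setT x = to_setT y.
  by apply: (inj (f := f)) fxy; rewrite inE.
have fS : f @` setT #= [set: T] by apply: inj_card_eq => x y _ _; exact: finj.
by rewrite -(card_le_eql fS); exact: subset_card_le.
Qed.

Lemma sval_inj (T : Type) (P : T -> Prop) :
  injective (fun s : {x | P x} => sval s).
Proof. by move=> [x Px] [y Py]; exact: eq_exist. Qed.

Lemma card_sig (T : Type) (A : set T) : [set: {x | A x}] #= A.
Proof.
rewrite -(card_eql (inj_card_eq (in2W (@sval_inj T A)))).
suff -> : [set sval s | s in [set: {x | A x}]] = A by exact: card_eqxx.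
by apply/seteqP; split=> [_ [s _ <-]|x Ax]; [exact: svalP|exists (exist _ x Ax)].
Qed.

(** A set of choice functions all of whose projections are injective, and which
    is maximal with this property, has an onto projection: otherwise a choice
    function avoiding every projection could be added to it.  If the projection
    to [T i] is onto, then a section of it followed by the projection to [T j]
    embeds [T i] into [T j]. *)
Lemma card_le_min (I : Type) (i0 : I) (T : I -> Type) :
  exists i, forall j, [set: T i] #<= [set: T j].
Proof.
pose inj_proj (S : set (forall i, T i)) :=
  forall i x y, S x -> S y -> x i = y i -> x = y.
have [|S [Sinj Smax]] := @Zorn_bigcup _ inj_proj.
  move=> F Finj Ftot i x y [X FX Xx] [Y FY Yy].
  have [XY|YX] := Ftot _ _ FX FY.
    by apply: (Finj _ FY i) => //; exact: XY.
  by apply: (Finj _ FX i) => //; exact: YX.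
have [i Si] : exists i, forall t : T i, exists2 x, S x & x i = t.
  apply: contrapT => /forallNP noti.
  have t i : {t : T i | forall x, S x -> x i <> t}.
    apply: cid; have /existsNP[t tP] := noti i.
    by exists t => x Sx xt; apply: tP; exists x.
  pose u i := sval (t i).
  have uS x i : S x -> x i <> u i by exact: svalP (t i) x.
  have Su : S `<` u |` S.
    split; first by move=> x Sx; right.
    by move=> /(_ u (or_introl erefl)) Su; exact: uS u i0 Su erefl.
  apply: (Smax _ Su) => i x y [->|Sx] [->|Sy] // xyi.
  - by case: (uS _ i Sy).
  - by case: (uS _ i Sx).
  - exact: (Sinj i).
exists i => j; apply/card_leTTP.
have /choice[s sP] : forall t : T i, exists x, S x /\ x i = t.
  by move=> t; have [x Sx xt] := Si t; exists x.
exists (fun t => s t j) => t u /(Sinj j _ _ (sP t).1 (sP u).1) stu.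
by rewrite -(sP t).2 -(sP u).2 stu.
Qed.

(** * Cardinals and their minima *)

Lemma cle_total (k l : cardinal) : cle k l \/ cle l k.
Proof.
have [[] kl] := card_le_min true (fun b : bool => if b then k else l).
  by left; exact: kl false.
by right; exact: kl true.
Qed.

Lemma cmin_spec (C : set cardinal) k : C k ->
  C (cmin C) /\ forall l, C l -> cle (cmin C) l.
Proof.
move=> Ck.
have [[m Cm] minm] :=
  card_le_min (exist C k Ck) (fun l : {l | C l} => sval l : Type).
apply: (xgetPex omega (P := [set k | C k /\ forall l, C l -> cle k l])).
by exists m; split=> // l Cl; exact: minm (exist C l Cl).
Qed.

(** Stated for a bare type rather than an [eqType]: cardinals themselves form an
    [eqType], which forces the universe of the latter above that of the
    underlying types of cardinals. *)
Lemma exists_well_order (T : Type) : exists R : rel T, well_order R.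
Proof.
elim/Peq: T => T.
by have [R Rwo] := well_ordering_principle T; exists R.
Qed.

Lemma well_order_anti (T : Type) (R : rel T) (x y : T) :
  well_order R -> R x y -> R y x -> x = y.
Proof.
elim/Peq: T => T in R x y *; move=> Rwo xy yx.
have Rch : wo_chain R predT by move=> A _; exact: Rwo.
by apply: (wo_chain_antisymmetric Rch); rewrite ?inE ?xy.
Qed.

Lemma well_order_preim (U T : Type) (f : U -> T) (R : rel T) :
  injective f -> well_order R -> well_order (fun x y => R (f x) (f y)).
Proof.
move=> finj Rwo A [a Aa].
have [|_ [[/asboolP[z Az <-] lz] uz]] :=
  Rwo (fun x => `[< exists2 u, u \in A & f u = x >]).
  by exists (f a); apply/asboolP; exists a.
exists z; split=> [|w [Aw lw]].
  by split=> // w Aw; apply: lz; apply/asboolP; exists w.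
apply: finj; apply: uz; split; first by apply/asboolP; exists w.
by move=> _ /asboolP[v Av <-]; exact: lw.
Qed.

(** Well-order [T].  If [T] injects into a proper initial segment, take the
    least [z] whose segment is large enough; that segment is an initial
    well-order by minimality of [z], and has the size of [T]. *)
Lemma exists_cardinal (T : Type) : exists k : cardinal, [set: k] #= [set: T].
Proof.
have [R Rwo] := exists_well_order T.
pose seg x : set T := [set y | R y x /\ y <> x].
have [[x0 Tx0]|/forallNP noseg] := pselect (exists x, [set: T] #<= seg x);
  last by exists (Cardinal Rwo noseg).
have [|z [[/asboolP Tz lz] _]] := Rwo (fun x => `[< [set: T] #<= seg x >]).
  by exists x0; apply/asboolP.
pose S := {x | seg z x}; pose v (s : S) := sval s.
have vinj : injective v := @sval_inj _ (seg z).
have cS : [set: S] #= seg z := card_sig (seg z).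
have ini (s : S) : ~ ([set: S] #<= [set t : S | R (v t) (v s) /\ t <> s]).
  move=> Ss; have [sz nsz] := svalP s.
  apply: nsz; apply: (well_order_anti Rwo) => //; apply: lz; apply/asboolP.
  apply: (card_le_trans Tz); rewrite -(card_le_eql cS).
  apply: (card_le_trans Ss).
  rewrite -(card_le_eql (inj_card_eq (in2W vinj))).
  apply: subset_card_le => _ [t [ts nts] <-]; split=> // /vinj.
  exact: nts.
exists (Cardinal (well_order_preim vinj Rwo) ini) => /=.
apply: card_eq_trans cS _.
by apply: Cantor_Bernstein => //; exact: subset_card_le.
Qed.

Lemma exists_cardinal_set (T : Type) (A : set T) :
  exists k : cardinal, [set: k] #= A.
Proof.
have [k kA] := exists_cardinal {x | A x}.
by exists k; exact: card_eq_trans kA (card_sig A).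
Qed.

(** * Cofinality and the bounding number *)

Lemma cofinality_attained (P : poset) :
  exists2 A : set P, cofinal A & [set: cofinality P] #= A.
Proof.
have [k kP] := exists_cardinal P.
apply: (proj1 (@cmin_spec [set k | exists2 A : set P, cofinal A & [set: k] #= A]
  k _)).
by exists setT => // x; exists x => //; exact: poset_refl.
Qed.

Lemma cofinality_le (P : poset) (A : set P) :
  cofinal A -> [set: cofinality P] #<= A.
Proof.
move=> Acof; have [k kA] := exists_cardinal_set A.
have Ck : [set k | exists2 A : set P, cofinal A & [set: k] #= A] k by exists A.
by rewrite -(card_le_eqr kA); exact: (cmin_spec Ck).2.
Qed.

Lemma frak_b_le (A : set (nat -> nat)) :
  ~ (exists g, forall f, A f -> le_star f g) -> [set: frak_b] #<= A.
Proof.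
move=> Aunb; have [k kA] := exists_cardinal_set A.
rewrite -(card_le_eqr kA).
have Ck : [set k | exists2 A : set (nat -> nat),
   ~ (exists g, forall f, A f -> le_star f g) & [set: k] #= A] k by exists A.
exact: (cmin_spec Ck).2.
Qed.

(** * Monotone cofinal maps *)

(** Index the cofinal set by [L] and let [h] escape, at the coordinate of [a],
    the value there of the image of [a].  Then [h] is below the image of no
    member of [A], hence of no element of [P]. *)
Lemma not_succeq_power (P Q : poset) (L : Type) (A : set P) :
  (forall q : Q, exists q', ~ poset_le q' q) ->
  cofinal A -> A #<= [set: L] -> ~ succeq P (power Q L).
Proof.
move=> Qmax Acof; rewrite -(card_le_eql (card_sig A)).
move=> /card_leTTP[i iinj] [f [fmono fcof]].
(* Coordinates that are not in the image of [i] get an arbitrary value. *)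
have /choice[h hP] : forall l : L, exists q : Q, forall a, i a = l ->
    ~ poset_le q (f (sval a) l).
  move=> l.
  have [[a al]|noa] := pselect (exists a, i a = l).
    have [q qP] := Qmax (f (sval a) l).
    by exists q => b; rewrite -al => /iinj ->; rewrite al.
  have [q] := poset_inhabited Q.
  by exists q => a al; case: noa; exists a.
have [p hp] := fcof h; have [a Aa pa] := Acof p.
apply: (hP _ (exist _ a Aa) erefl).
exact: poset_trans (hp _) (fmono _ _ pa _).
Qed.

Lemma succeq_power (P : poset) (I J : Type) :
  [set: I] #<= [set: J] -> succeq (power P J) (power P I).
Proof.
move=> /card_leTTP[i iinj]; exists (fun f x => f (i x)); split=> [f f' ff' /= x|q].
  exact: ff'.
have /choice[f fP] : forall j : J, exists y : P, forall x, i x = j -> y = q x.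
  move=> j.
  have [[x <-]|nox] := pselect (exists x, i x = j).
    by exists (q x) => y /iinj ->.
  have [y] := poset_inhabited P.
  by exists y => x xj; case: nox; exists x.
by exists f => /= x; rewrite (fP _ x erefl); exact: poset_refl.
Qed.

Lemma finite_bounded (f : nat -> nat) (A : set nat) : finite_set A ->
  exists m, forall n, A n -> f n <= m.
Proof.
move=> /finite_seqP[s ->]; exists (\max_(n <- s) f n) => n ns.
exact: leq_bigmax_seq.
Qed.

(** A function that is below [G] off a finite set is below [max(G, m)] for some
    constant [m], so below [frak_b] the order modulo finite sets costs only
    countably many true bounds. *)
Lemma succeq_below_frak_b (k : cardinal) (k0 : inhabited k) :
  succeq omega_omega (cardinal_poset k0) -> ~ cle frak_b k ->
  cle (cofinality (cardinal_poset k0)) omega.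
Proof.
move=> [g [gmono gcof]] bk.
have [p pP] := choice gcof.
have [G GP] : exists G, forall f, range p f -> le_star f G.
  apply: contrapT => /frak_b_le bp; apply: bk.
  exact: card_le_trans bp (card_image_le _ _).
pose Gmax m : omega_omega := fun n => maxn (G n) m.
have cof : cofinal (range (fun m => g (Gmax m))).
  move=> x; have [m mP] := finite_bounded (p x) (GP _ (imageT p x)).
  exists (g (Gmax m)); first exact: imageT.
  apply: poset_trans (pP x) (gmono _ _ _); rewrite /= => n /=.
  rewrite leq_max; have [//|pn] := boolP (p x n <= G n).
  exact: mP (negP pn).
exact: card_le_trans (cofinality_le cof) (card_image_le _ _).
Qed.

(** A maximum would be a one-point cofinal set. *)
Lemma no_max_of_cofinality (P : poset) : cle omega (cofinality P) ->
  forall x : P, exists y, ~ poset_le y x.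
Proof.
move=> wP x; apply: contrapT => /forallNP xmax.
have cof : cofinal [set x].
  by move=> y; exists x => //; apply: contrapT; exact: xmax.
apply: infinite_nat; apply: (@card_le_finite _ _ _ [set x]); last exact: finite_set1.
exact: card_le_trans wP (cofinality_le cof).
Qed.

(** * Regular cardinals below their exponent *)

Lemma regular_lt_frak_e_countable (k : cardinal) (k0 : inhabited k) :
  ceq frak_b frak_d ->
  cle omega (cofinality (cardinal_poset k0)) ->
  ceq (cofinality (cardinal_poset k0)) k ->
  clt k (frak_e k0) -> cle k omega.
Proof.
move=> bd wcof cofk [_ ek].
have : succeq omega_omega (power (cardinal_poset k0) k).
  apply: contrapT => Nsucc; apply: ek.
  by apply: (@cmin_spec [set l : cardinal |
    ~ succeq omega_omega (power (cardinal_poset k0) l)] k Nsucc).2.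
(* The two cases [d <= k] and [k < b] exhaust everything because [b = d]. *)
have [dk|dk] := pselect (cle frak_d k).
  have [A Acof dA] := cofinality_attained omega_omega.
  move=> succ; exfalso; move: succ.
  apply: (not_succeq_power (no_max_of_cofinality wcof) Acof).
  by rewrite -(card_le_eql dA).
(* Evaluating at [x0] turns a map to [k^k] into one to [k]. *)
move=> [f [fmono fcof]]; have [x0] := k0.
rewrite /cle -(card_le_eql cofk).
apply: succeq_below_frak_b; last by rewrite /cle (card_le_eql bd).
exists (fun p => f p x0); split=> [p p' /fmono/(_ x0) //|q].
by have [p /(_ x0)] := fcof (fun=> q); exists p.
Qed.

Definition nat_poset : poset := cardinal_poset (inhabits 0 : inhabited omega).

Lemma cofinality_omega : ceq (cofinality nat_poset) omega.
Proof.
apply: Cantor_Bernstein.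
  by apply: (@cofinality_le _ setT) => x; exists x => //; exact: poset_refl.
have [A Acof cA] := cofinality_attained nat_poset.
rewrite (card_le_eqr cA); apply/infiniteP => /(finite_bounded id)[m mP].
by have [a /mP am] := Acof m.+1; rewrite /= leqNgt ltnS am.
Qed.

(** The diagonal argument with the index set [nat -> nat] shows that the class
    defining [frak_e] is non-empty, so [frak_e] belongs to it and inherits its
    property; countable exponents lack that property. *)
Lemma omega_lt_frak_e : clt omega (frak_e (inhabits 0 : inhabited omega)).
Proof.
have [l lP] := exists_cardinal (nat -> nat).
have Nl : ~ succeq omega_omega (power nat_poset l).
  apply: (@not_succeq_power _ _ _ setT).
  - by move=> n; exists n.+1; rewrite /= ltnn.
  - by move=> x; exists x => //; exact: poset_refl.
  - by rewrite (card_le_eqr lP).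
have [Ne _] := @cmin_spec
  [set l : cardinal | ~ succeq omega_omega (power nat_poset l)] l Nl.
have ew : ~ cle (frak_e (inhabits 0 : inhabited omega)) omega.
  by move=> ew; apply: Ne; exact: succeq_power.
by split=> //; have [] := cle_total omega (frak_e (inhabits 0 : inhabited omega)).
Qed.

(** * The supremum *)

Lemma csucc_ceq (k l : cardinal) : ceq k l -> csucc k = csucc l.
Proof.
move=> kl; congr cmin; apply/funext => m; apply/propext.
by rewrite /= /clt /cle (card_le_eql kl) (card_le_eqr kl).
Qed.

Lemma csup_set1 (m : cardinal) : ceq (csup [set m]) m.
Proof.
have mm : [set k | forall l, [set m] l -> cle l k] m by move=> _ ->; exact: card_lexx.
have [mge mle] := cmin_spec mm.
by apply: Cantor_Bernstein; [exact: mle|exact: mge].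
Qed.

Theorem corollary4p7 : ceq frak_b frak_d -> ceq frak_e_sharp omega1.
Proof.
move=> bd; rewrite /frak_e_sharp.
have -> : [set m | exists (k : cardinal) (k0 : inhabited k),
    [/\ cle omega (cofinality (cardinal_poset k0)),
        ceq (cofinality (cardinal_poset k0)) k,
        clt k (frak_e k0) &
        m = csucc k]] = [set omega1]; last exact: csup_set1.
apply/seteqP; split=> [m [k [k0 [wcof cofk ke ->]]]|_ ->].
  apply: csucc_ceq; apply: Cantor_Bernstein.
    exact: regular_lt_frak_e_countable ke.
  by rewrite /cle (card_le_eqr cofk) in wcof.
exists omega, (inhabits 0); split=> //.
- by have /card_eqPle[] := cofinality_omega.
- exact: cofinality_omega.
- exact: omega_lt_frak_e.
Qed.
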